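(* Let $F$ be the objective function of the optimization problem (P) described in the context, and assume (A1) $\tau\|\cdot\|_{2,\psi}$ is $\rho_1$-weakly convex, and (A2) $\Phi_\Sigma$ is coercive and $\rho_2$-weakly convex, where $\rho_1,\rho_2\ge 0$. Let $\alpha_{\mathcal S},\alpha_{\mathcal Z}\ge 0$ and $\alpha_E>0$ satisfy $\alpha_{\mathcal S}+(\alpha_{\mathcal S}+\delta-\rho_1)_+>0$ and $\alpha_{\mathcal Z}+(\alpha_{\mathcal Z}+\delta-\rho_2)_+>0$, where $(t)_+=\max\{t,0\}$. Let $\{(\mathcal Z^k,E^k,\mathcal S^k)\}_{k\ge0}$ be a sequence generated by the PnP-PBCD algorithm (described in the context) with these parameters. Then every accumulation point of $\{(\mathcal Z^k,E^k,\mathcal S^k)\}$ is a first-order stationary point of problem (P).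
   Context: **Notation.** $n_1,n_2,n_3,r$ are positive integers with $n_3\ge r$; $\mathcal O\in\mathbb R^{n_1\times n_2\times n_3}$ is a given tensor; $\delta,\tau>0$. For $\mathcal Z\in\mathbb R^{n_1\times n_2\times r}$ and $E\in\mathbb R^{n_3\times r}$, the mode-3 product $\mathcal Z\times_3E\in\mathbb R^{n_1\times n_2\times n_3}$ has entries $(\mathcal Z\times_3E)_{i_1i_2j}=\sum_{i_3=1}^r z_{i_1i_2i_3}E_{ji_3}$. $Z_{::n}\in\mathbb R^{n_1\times n_2}$ is the $n$-th frontal slice of $\mathcal Z$. $\mathbb S_{n_3,r}=\{E\in\mathbb R^{n_3\times r}:E^\top E=I_r\}$ is the Stiefel manifold. $\|\cdot\|_F$ is the Frobenius norm. All spaces of tensors and matrices are Euclidean spaces with the entrywise inner product. **Weak convexity, coercivity.** A proper lower semicontinuous function $f:\mathbb R^d\to(-\infty,+\infty]$ bounded below is $\rho$-weakly convex ($\rho\ge0$) if $f+\frac\rho2\|\cdot\|^2$ is convex. $f$ is coercive if $f(x)\to\infty$ as $\|x\|\to\infty$. **Group sparsity measure.** For a given function $\psi:\mathbb R\to[0,+\infty)$ (a sparsity-promoting function, e.g. $\psi(t)=|t|$ or $\psi(t)=(|t|+\varepsilon)^p-\varepsilon^p$ with $p\in(0,1)$, $\varepsilon>0$, or MCP, or SCAD), $\|\mathcal S\|_{2,\psi}=\sum_{i=1}^{n_1}\sum_{j=1}^{n_2}\psi(\|s_{ij:}\|_2)$ for $\mathcal S\in\mathbb R^{n_1\times n_2\times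 n_3}$, where $\|s_{ij:}\|_2=(\sum_{n=1}^{n_3}s_{ijn}^2)^{1/2}$. **Denoiser prior.** For each noise level $\sigma\in\{\sigma_1,\dots,\sigma_r\}$, let $g_\sigma:\mathbb R^{n_1\times n_2}\to\mathbb R$, $g_\sigma(X)=\frac12\|X-\mathcal N_\sigma(X)\|_F^2$ with $\mathcal N_\sigma$ a $\mathcal C^2$ map (neural network), $g_\sigma$ of class $\mathcal C^2$ and $\nabla g_\sigma$ $L_{g_\sigma}$-Lipschitz. Fix $\gamma\in[0,1]$ with $\gamma L_{g_\sigma}<1$, and put $\mathcal D_\sigma^\gamma=\mathrm{Id}-\gamma\nabla g_\sigma$ (which is injective). Define $\phi_\sigma^\gamma(X)=\gamma g_\sigma((\mathcal D_\sigma^\gamma)^{-1}(X))-\frac12\|(\mathcal D_\sigma^\gamma)^{-1}(X)-X\|_F^2$ if $X\in\operatorname{Im}(\mathcal D_\sigma^\gamma)$ and $+\infty$ otherwise; it is nonnegative. For fixed constants $a>0$, $b\in\mathbb R$ (added entrywise) let $\widetilde\phi_\sigma^\gamma(Z)=\frac1{a^2}\phi_\sigma^\gamma(aZ+b)$. For fixed $\lambda>0$, $\Phi_\Sigma(\mathcal Z)=\lambda\sum_{n=1}^r\widetilde\phi_{\sigma_n}^\gamma(Z_{::n})$, where $\Sigma=\operatorname{diag}(\sigma_1,\dots,\sigma_r)$. **Problem (P).** Minimize $F(\mathcal Z,E,\mathcal S)=H(\mathcal Z,E,\mathcal S)+\tau\|\mathcal S\|_{2,\psi}+\Phi_\Sigma(\mathcal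 Z)$ subject to $E^\top E=I_r$, where $H(\mathcal Z,E,\mathcal S)=\frac\delta2\|\mathcal Z\times_3E+\mathcal S-\mathcal O\|_F^2$. **PnP-PBCD algorithm.** Start from any $(\mathcal Z^0,E^0,\mathcal S^0)$ with $(E^0)^\top E^0=I_r$, and for $k=0,1,2,\dots$ compute $$\mathcal S^{k+1}\in\arg\min_{\mathcal S}\;H(\mathcal Z^k,E^k,\mathcal S)+\tau\|\mathcal S\|_{2,\psi}+\tfrac{\alpha_{\mathcal S}}2\|\mathcal S-\mathcal S^k\|_F^2,$$ $$E^{k+1}\in\arg\min_{E\in\mathbb S_{n_3,r}}\;H(\mathcal Z^k,E,\mathcal S^{k+1})+\tfrac{\alpha_E}2\|E-E^k\|_F^2,$$ $$\mathcal Z^{k+1}\in\arg\min_{\mathcal Z}\;H(\mathcal Z,E^{k+1},\mathcal S^{k+1})+\Phi_\Sigma(\mathcal Z)+\tfrac{\alpha_{\mathcal Z}}2\|\mathcal Z-\mathcal Z^k\|_F^2.$$ **Stationarity.** For proper lower semicontinuous $f$, the Fréchet subdifferential $\hat\partial f(x)$ at $x\in\operatorname{dom}f$ is the set of $u$ with $\liminf_{y\to x,y\ne x}\frac{f(y)-f(x)-\langle u,y-x\rangle}{\|y-x\|}\ge0$; the limiting subdifferential $\partial f(x)$ is the set of $u$ for which there are $x^k\to x$ with $f(x^k)\to f(x)$ and $u^k\in\hat\partial f(x^k)$ with $u^k\to u$. The Riemannian gradient on $\mathbb S_{n_3,r}$ of a smooth function $f$ at $X$ is $\operatorname{grad}f(X)=\operatorname{Proj}_{\mathcal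 T_X}(\nabla f(X))$ with $\operatorname{Proj}_{\mathcal T_X}(Y)=Y-\frac12X(X^\top Y+Y^\top X)$. A point $(\bar{\mathcal Z},\bar E,\bar{\mathcal S})$ is a first-order stationary point of (P) if $0\in\nabla_{\mathcal S}H(\bar{\mathcal Z},\bar E,\bar{\mathcal S})+\tau\,\partial\|\cdot\|_{2,\psi}(\bar{\mathcal S})$; $\;0=\operatorname{grad}_EH(\bar{\mathcal Z},\bar E,\bar{\mathcal S})$ and $\bar E^\top\bar E=I_r$; $\;0\in\nabla_{\mathcal Z}H(\bar{\mathcal Z},\bar E,\bar{\mathcal S})+\partial\Phi_\Sigma(\bar{\mathcal Z})$. *)

(* Defs.v *)
From HB Require Import structures.
From mathcomp Require Import all_boot all_order all_algebra.
From mathcomp Require Import all_classical all_reals all_analysis.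

Set Implicit Arguments.
Unset Strict Implicit.
Unset Printing Implicit Defensive.

Import Order.TTheory GRing.Theory Num.Theory.
Import numFieldNormedType.Exports.

Local Open Scope classical_set_scope.
Local Open Scope ring_scope.

(* The topology of 'M[R]_(m, n) is the product topology of its entries.
   The library norm `|A| is the max norm, hence the explicit Euclidean one. *)
Definition finner (R : realType) (m n : nat) (A B : 'M[R]_(m, n)) : R :=
  \sum_(i < m) \sum_(j < n) A i j * B i j.

Definition fnorm (R : realType) (m n : nat) (A : 'M[R]_(m, n)) : R :=
  Num.sqrt (finner A A).

(* A tensor in R^(n1 x n2 x n3) is stored as the matrix whose row
   mxvec_index i j is the tube s_(ij:); its (i, j, k) entry is
   S (mxvec_index i j) k, and the entrywise inner product and the topology are
   those of the matrix. *)
Notation tensor R n1 n2 n3 := 'M[R]_(n1 * n2, n3).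

Definition tube (R : realType) (n1 n2 n3 : nat) (S : tensor R n1 n2 n3)
    (i : 'I_n1) (j : 'I_n2) : 'rV[R]_n3 :=
  row (mxvec_index i j) S.

Definition frontal_slice (R : realType) (n1 n2 n3 : nat)
    (Z : tensor R n1 n2 n3) (k : 'I_n3) : 'M[R]_(n1, n2) :=
  \matrix_(i < n1, j < n2) Z (mxvec_index i j) k.

Definition mode3_prod (R : realType) (n1 n2 n3 r : nat)
    (Z : tensor R n1 n2 r) (E : 'M[R]_(n3, r)) : tensor R n1 n2 n3 :=
  \matrix_(p < n1 * n2, j < n3) \sum_(k < r) Z p k * E j k.

Definition stiefel (R : realType) (n r : nat) : set 'M[R]_(n, r) :=
  [set E | E^T *m E = 1%:M].

Arguments stiefel : clear implicits.

Section ExtendedRealFunctions.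
Local Open Scope ereal_scope.

Definition proper_fun (T : Type) (R : realType) (f : T -> \bar R) : Prop :=
  (forall x, f x != -oo) /\ (exists x, f x < +oo).

Definition bounded_below (T : Type) (R : realType) (f : T -> \bar R) : Prop :=
  exists c : R, forall x, c%:E <= f x.

Definition convex_efun (R : realType) (m n : nat)
    (f : 'M[R]_(m, n) -> \bar R) : Prop :=
  forall (x y : 'M[R]_(m, n)) (t : R), (0 <= t <= 1)%R ->
    f (t *: x + (1 - t) *: y)%R <= t%:E * f x + (1 - t)%:E * f y.

Definition weakly_convex (R : realType) (m n : nat) (rho : R)
    (f : 'M[R]_(m, n) -> \bar R) : Prop :=
  [/\ proper_fun f, lower_semicontinuous f, bounded_below f, (0 <= rho)%R
    & convex_efun (fun x => f x + (rho / 2 * fnorm x ^+ 2)%:E)].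

Definition coercive (R : realType) (m n : nat)
    (f : 'M[R]_(m, n) -> \bar R) : Prop :=
  forall M : R, exists K : R, forall x, (K < fnorm x)%R -> M%:E < f x.

Definition argmin (T : Type) (R : realType) (C : set T) (f : T -> \bar R) :
    set T :=
  [set x | C x /\ forall y, C y -> f x <= f y].

Definition frechet_subdiff (R : realType) (m n : nat)
    (f : 'M[R]_(m, n) -> \bar R) (x : 'M[R]_(m, n)) : set 'M[R]_(m, n) :=
  [set u | f x \is a fin_num /\
    0 <= limf_einf (fun y => (f y - f x - (finner u (y - x)%R)%:E)
                             * ((fnorm (y - x)%R)^-1)%:E) x^'].

Definition limiting_subdiff (R : realType) (m n : nat)
    (f : 'M[R]_(m, n) -> \bar R) (x : 'M[R]_(m, n)) : set 'M[R]_(m, n) :=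
  [set u | f x \is a fin_num /\
    exists (xs us : nat -> 'M[R]_(m, n)),
      [/\ xs k @[k --> \oo] --> x,
          f (xs k) @[k --> \oo] --> f x,
          (forall k, frechet_subdiff f (xs k) (us k))
        & us k @[k --> \oo] --> u]].

End ExtendedRealFunctions.

Fixpoint class_C (R : realType) (V W : normedModType R) (k : nat)
    (f : V -> W) : Prop :=
  if k is k'.+1
  then (forall x, differentiable f x) /\ (forall v, class_C k' ('D_v f))
  else continuous f.

Definition grad (R : realType) (m n : nat) (f : 'M[R]_(m, n) -> R)
    (X : 'M[R]_(m, n)) : 'M[R]_(m, n) :=
  \matrix_(i < m, j < n) 'D_(delta_mx i j) f X.

Definition proj_tangent (R : realType) (n r : nat) (X Y : 'M[R]_(n, r)) :
    'M[R]_(n, r) :=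
  Y - 2^-1 *: (X *m (X^T *m Y + Y^T *m X)).

Definition rgrad (R : realType) (n r : nat) (f : 'M[R]_(n, r) -> R)
    (X : 'M[R]_(n, r)) : 'M[R]_(n, r) :=
  proj_tangent X (grad f X).

Definition group_sparsity (R : realType) (n1 n2 n3 : nat) (psi : R -> R)
    (S : tensor R n1 n2 n3) : R :=
  \sum_(i < n1) \sum_(j < n2) psi (fnorm (tube S i j)).

Definition g_denoise (R : realType) (n1 n2 : nat)
    (N : 'M[R]_(n1, n2) -> 'M[R]_(n1, n2)) (X : 'M[R]_(n1, n2)) : R :=
  2^-1 * fnorm (X - N X) ^+ 2.

Definition lipschitz_grad (R : realType) (m n : nat) (L : R)
    (g : 'M[R]_(m, n) -> R) : Prop :=
  forall X Y, fnorm (grad g X - grad g Y) <= L * fnorm (X - Y).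

Definition denoiser (R : realType) (m n : nat) (gamma : R)
    (g : 'M[R]_(m, n) -> R) (X : 'M[R]_(m, n)) : 'M[R]_(m, n) :=
  X - gamma *: grad g X.

(* xget 0 picks a preimage, which is unique when the denoiser is injective. *)
Definition denoiser_inv (R : realType) (m n : nat) (gamma : R)
    (g : 'M[R]_(m, n) -> R) (X : 'M[R]_(m, n)) : 'M[R]_(m, n) :=
  xget 0 (denoiser gamma g @^-1` [set X]).

Definition phi (R : realType) (m n : nat) (gamma : R)
    (g : 'M[R]_(m, n) -> R) (X : 'M[R]_(m, n)) : \bar R :=
  if `[< range (denoiser gamma g) X >] then
    (gamma * g (denoiser_inv gamma g X)
     - 2^-1 * fnorm (denoiser_inv gamma g X - X) ^+ 2)%:E
  else +oo%E.

Definition phi_tilde (R : realType) (m n : nat) (gamma a b : R)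
    (g : 'M[R]_(m, n) -> R) (Z : 'M[R]_(m, n)) : \bar R :=
  (((a ^+ 2)^-1)%R%:E * phi gamma g (a *: Z + const_mx b)%R)%E.

(* The networks are indexed by the noise level; sigma lists the diagonal of
   Sigma. *)
Definition Phi (R : realType) (n1 n2 r : nat) (lambda gamma a b : R)
    (N : R -> 'M[R]_(n1, n2) -> 'M[R]_(n1, n2)) (sigma : 'I_r -> R)
    (Z : tensor R n1 n2 r) : \bar R :=
  (lambda%:E * \sum_(k < r)
     phi_tilde gamma a b (g_denoise (N (sigma k))) (frontal_slice Z k))%E.

Definition data_fit (R : realType) (n1 n2 n3 r : nat) (delta : R)
    (O : tensor R n1 n2 n3) (Z : tensor R n1 n2 r) (E : 'M[R]_(n3, r))
    (S : tensor R n1 n2 n3) : R :=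
  delta / 2 * fnorm (mode3_prod Z E + S - O) ^+ 2.

Section Problem.
Context (R : realType) (n1 n2 n3 r : nat) (O : tensor R n1 n2 n3)
  (delta tau : R) (psi : R -> R) (Reg : tensor R n1 n2 r -> \bar R).

(* The problem is to minimize objective subject to stiefel E; Reg is the
   regularizer, instantiated with Phi. *)
Definition objective (Z : tensor R n1 n2 r) (E : 'M[R]_(n3, r))
    (S : tensor R n1 n2 n3) : \bar R :=
  ((data_fit delta O Z E S)%:E + (tau * group_sparsity psi S)%:E + Reg Z)%E.

Definition first_order_stationary (Z : tensor R n1 n2 r) (E : 'M[R]_(n3, r))
    (S : tensor R n1 n2 n3) : Prop :=
  [/\ exists2 u, limiting_subdiff (EFin \o group_sparsity psi) S u
        & grad (data_fit delta O Z E) S + tau *: u = 0,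
      rgrad (fun E' => data_fit delta O Z E' S) E = 0,
      stiefel R n3 r E
    & exists2 v, limiting_subdiff Reg Z v
        & grad (fun Z' => data_fit delta O Z' E S) Z + v = 0].

Definition pnp_pbcd (alphaS alphaE alphaZ : R) (Z : nat -> tensor R n1 n2 r)
    (E : nat -> 'M[R]_(n3, r)) (S : nat -> tensor R n1 n2 n3) : Prop :=
  stiefel R n3 r (E 0%N) /\
  forall k : nat,
    [/\ argmin setT
          (fun S' => (data_fit delta O (Z k) (E k) S'
                      + tau * group_sparsity psi S'
                      + alphaS / 2 * fnorm (S' - S k) ^+ 2)%:E) (S k.+1),
        argmin (stiefel R n3 r)
          (fun E' => (data_fit delta O (Z k) E' (S k.+1)
                      + alphaE / 2 * fnorm (E' - E k) ^+ 2)%:E) (E k.+1)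
      & argmin setT
          (fun Z' => ((data_fit delta O Z' (E k.+1) (S k.+1))%:E + Reg Z'
                      + (alphaZ / 2 * fnorm (Z' - Z k) ^+ 2)%:E)%E) (Z k.+1)].

End Problem.

(* Main.v *)
(** Each block update gains a fixed multiple of the squared step, so successive
    iterates of the whole sequence merge and the optimality inequalities of the
    three subproblems pass to the limit along a convergent subsequence. Hence
    each block of an accumulation point globally minimizes its own proximal
    subproblem centered at itself. For S and Z the smooth part is quadratic, so
    minimality is a quadratic minorant, i.e. a Fréchet subgradient at the point
    itself: constant sequences witness the limiting subdifferential. For E the
    subproblem is linear on the Stiefel manifold, and testing it against plane
    rotations makes the Riemannian gradient vanish. *)
Require Import Defs.
From HB Require Import structures.
From mathcomp Require Import all_boot all_order all_algebra.
From mathcomp Require Import all_classical all_reals all_analysis.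
From mathcomp Require Import ring lra.

Set Implicit Arguments.
Unset Strict Implicit.
Unset Printing Implicit Defensive.

Import Order.TTheory GRing.Theory Num.Theory.
Import numFieldNormedType.Exports.

Local Open Scope classical_set_scope.
Local Open Scope ring_scope.

(** * Euclidean geometry of matrices under the entrywise inner product *)

Section FrobeniusInner.
Context {R : realType} {m n : nat}.
Implicit Types A B C : 'M[R]_(m, n).

Lemma finner_trace A B : finner A B = \tr (A *m B^T).
Proof.
by apply: eq_bigr => i _; rewrite mxE; apply: eq_bigr => j _; rewrite mxE.
Qed.

Lemma finnerC A B : finner A B = finner B A.
Proof. by rewrite !finner_trace -mxtrace_tr trmx_mul trmxK. Qed.

Lemma finnerDl A B C : finner (A + B) C = finner A C + finner B C.
Proof. by rewrite !finner_trace mulmxDl mxtraceD. Qed.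

Lemma finnerZl a A B : finner (a *: A) B = a * finner A B.
Proof. by rewrite !finner_trace -scalemxAl mxtraceZ. Qed.

Lemma finnerNl A B : finner (- A) B = - finner A B.
Proof. by rewrite -scaleN1r finnerZl mulN1r. Qed.

Lemma finnerDr A B C : finner A (B + C) = finner A B + finner A C.
Proof. by rewrite finnerC finnerDl !(finnerC A). Qed.

Lemma finnerZr a A B : finner A (a *: B) = a * finner A B.
Proof. by rewrite finnerC finnerZl finnerC. Qed.

Lemma finnerNr A B : finner A (- B) = - finner A B.
Proof. by rewrite finnerC finnerNl finnerC. Qed.

Lemma finner_delta A i j : finner A (delta_mx i j) = A i j.
Proof.
rewrite /finner (bigD1 i)//= (bigD1 j)//= mxE !eqxx mulr1.
rewrite big1 => [|j' /negbTE j'j]; last by rewrite mxE j'j andbF mulr0.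
rewrite addr0 big1 ?addr0// => i' /negbTE i'i.
by rewrite big1// => j' _; rewrite mxE i'i mulr0.
Qed.

Lemma fnorm_sqr A : fnorm A ^+ 2 = finner A A.
Proof.
by rewrite sqr_sqrtr//; do 2! apply: sumr_ge0 => ? _; rewrite -expr2 sqr_ge0.
Qed.

Lemma fnorm_ge0 A : 0 <= fnorm A. Proof. exact: sqrtr_ge0. Qed.

Lemma fnorm0 : fnorm (0 : 'M[R]_(m, n)) = 0.
Proof. by rewrite /fnorm -(scale0r 0) finnerZl mul0r sqrtr0. Qed.

Lemma fnormZ_sqr a A : fnorm (a *: A) ^+ 2 = a ^+ 2 * fnorm A ^+ 2.
Proof. by rewrite !fnorm_sqr finnerZl finnerZr mulrA expr2. Qed.

Lemma fnormD_sqr A B :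
  fnorm (A + B) ^+ 2 = fnorm A ^+ 2 + 2 * finner A B + fnorm B ^+ 2.
Proof. by rewrite !fnorm_sqr finnerDl !finnerDr (finnerC B A); ring. Qed.

Lemma le_entry_fnorm A i j : `|A i j| <= fnorm A.
Proof.
rewrite -sqrtr_sqr ler_wsqrtr// /finner (bigD1 i)//= (bigD1 j)//= -expr2.
rewrite -addrA lerDl addr_ge0//; last apply: sumr_ge0 => i' _.
  by apply: sumr_ge0 => j' _; rewrite -expr2 sqr_ge0.
by apply: sumr_ge0 => j' _; rewrite -expr2 sqr_ge0.
Qed.

Lemma fnorm_neq0 A : A != 0 -> fnorm A != 0.
Proof.
apply: contra => /eqP A0; apply/eqP/matrixP => i j; rewrite mxE.
by apply/eqP; rewrite -normr_le0 -A0 le_entry_fnorm.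
Qed.

End FrobeniusInner.

Lemma finner_mulmxl (R : realType) m n p (A : 'M[R]_(m, p)) (B : 'M[R]_(p, n))
    (C : 'M[R]_(m, n)) : finner (A *m B) C = finner B (A^T *m C).
Proof.
by rewrite !finner_trace trmx_mul trmxK -mulmxA mxtrace_mulC mulmxA.
Qed.

Lemma finner_tr (R : realType) m n (A B : 'M[R]_(m, n)) :
  finner A^T B^T = finner A B.
Proof.
by rewrite !finner_trace trmxK mxtrace_mulC -mxtrace_tr trmx_mul trmxK.
Qed.

Lemma finner_mulmxr (R : realType) m n p (A : 'M[R]_(m, p)) (B : 'M[R]_(p, n))
    (C : 'M[R]_(m, n)) : finner (A *m B) C = finner A (C *m B^T).
Proof.
by rewrite -finner_tr trmx_mul finner_mulmxl -finner_tr trmx_mul !trmxK.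
Qed.

(** * Limits of matrix expressions, reduced to limits of entries *)

Section Convergence.
Context {R : realType} {T : Type} {F : set_system T} {FF : Filter F}.

Lemma cvg_sumr (I : Type) (s : seq I) (f : I -> T -> R) (a : I -> R) :
  (forall i, f i t @[t --> F] --> a i) ->
  \sum_(i <- s) f i t @[t --> F] --> \sum_(i <- s) a i.
Proof.
move=> fa.
exact (@cvg_big R I +%R 0 xpredT (@add_continuous R) T F s f a FF
  (fun i _ => fa i)).
Qed.

Lemma cvg_mx m n (A : T -> 'M[R]_(m, n)) (B : 'M[R]_(m, n)) :
  (forall i j, A t i j @[t --> F] --> B i j) -> A t @[t --> F] --> B.
Proof.
move=> AB; apply/cvg_ballP => e e0.
have : \forall t \near F, forall i j, ball (B i j) e (A t i j).
  apply: filter_forall => i; apply: filter_forall => j.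
  by move/cvg_ballP : (AB i j); apply.
by apply: filterS => t h; split.
Qed.

Lemma cvg_mx_entry m n (A : T -> 'M[R]_(m, n)) (B : 'M[R]_(m, n)) i j :
  A t @[t --> F] --> B -> A t i j @[t --> F] --> B i j.
Proof.
move=> AB; apply: (@cvg_comp _ _ _ A (fun M : 'M[R]_(m, n) => M i j)).
  exact: AB.
exact: coord_continuous.
Qed.

Lemma cvg_mulmx m n p (A : T -> 'M[R]_(m, n)) (B : T -> 'M[R]_(n, p))
    (A0 : 'M[R]_(m, n)) (B0 : 'M[R]_(n, p)) :
  A t @[t --> F] --> A0 -> B t @[t --> F] --> B0 ->
  A t *m B t @[t --> F] --> A0 *m B0.
Proof.
move=> hA hB; apply: cvg_mx => i j; rewrite mxE.
under eq_fun do rewrite mxE.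
by apply: cvg_sumr => k;  apply: cvgM; exact: cvg_mx_entry.
Qed.

Lemma cvg_trmx m n (A : T -> 'M[R]_(m, n)) (A0 : 'M[R]_(m, n)) :
  A t @[t --> F] --> A0 -> (A t)^T @[t --> F] --> A0^T.
Proof.
move=> hA; apply: cvg_mx => i j; rewrite mxE.
by under eq_fun do rewrite mxE; exact: cvg_mx_entry.
Qed.

Lemma cvg_finner m n (A B : T -> 'M[R]_(m, n)) (A0 B0 : 'M[R]_(m, n)) :
  A t @[t --> F] --> A0 -> B t @[t --> F] --> B0 ->
  finner (A t) (B t) @[t --> F] --> finner A0 B0.
Proof.
move=> hA hB; apply: cvg_sumr => i; apply: cvg_sumr => j.
by apply: cvgM; exact: cvg_mx_entry.
Qed.

Lemma cvg_fnorm_sqr m n (A : T -> 'M[R]_(m, n)) (A0 : 'M[R]_(m, n)) :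
  A t @[t --> F] --> A0 -> fnorm (A t) ^+ 2 @[t --> F] --> fnorm A0 ^+ 2.
Proof.
move=> hA; rewrite fnorm_sqr; under eq_fun do rewrite fnorm_sqr.
exact: cvg_finner.
Qed.

Lemma fnorm_sqr_cvg0 m n (A : T -> 'M[R]_(m, n)) :
  fnorm (A t) ^+ 2 @[t --> F] --> 0 -> A t @[t --> F] --> (0 : 'M[R]_(m, n)).
Proof.
move=> hA; apply: cvg_mx => i j; rewrite mxE.
apply/cvgr0Pnorm_lt => e e0.
move/cvgr0Pnorm_lt : hA => /(_ (e ^+ 2)); rewrite exprn_gt0// => /(_ isT).
apply: filterS => t; rewrite ger0_norm ?sqr_ge0//.
rewrite ltr_pXn2r ?nnegrE ?fnorm_ge0 ?ltW//.
exact/le_lt_trans/le_entry_fnorm.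
Qed.

End Convergence.

(** * Subgradients, gradients of quadratics, limits of minimizers and proximal descent *)

Section Subgradients.
Context {R : realType} {m n : nat}.
Implicit Types (x y u : 'M[R]_(m, n)) (f : 'M[R]_(m, n) -> \bar R).

(** [limf_einf] is a supremum of infima over members of [F]; the set where [- e <= g y] is such a
    member, with infimum at least [- e]. *)
Lemma limf_einf_ge0 (T : choiceType) (X : filteredType T) (g : X -> \bar R)
    (F : set_system X) :
  (forall e : R, 0 < e -> \forall y \near F, ((- e)%:E <= g y)%E) ->
  (0 <= limf_einf g F)%E.
Proof.
move=> h; rewrite limf_einfE; apply/lee_addgt0Pr => e e0.
rewrite -leeBlDr// sub0e; apply: le_ereal_sup_tmp.
exists (ereal_inf (g @` [set y | (- e)%:E <= g y]%E)).
  by exists [set y | (- e)%:E <= g y]%E => //; exact: h.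
by apply: le_ereal_inf_tmp => _ [y ? <-].
Qed.

(** The difference quotient is at least [- C * fnorm (y - x)], which vanishes as [y] tends to
    [x]. *)
Lemma frechet_subdiff_minorant f x u (C : R) :
  f x \is a fin_num ->
  (forall y, f x + (finner u (y - x) - C * fnorm (y - x) ^+ 2)%:E <= f y)%E ->
  frechet_subdiff f x u.
Proof.
move=> fx h; split=> //; apply: limf_einf_ge0 => e e0.
(* The sign of [C] is free; [|C| + 1] bounds it above and is a positive divisor even for [C = 0]. *)
have C0 : 0 < `|C| + 1 by rewrite ltr_wpDl.
have xx : y - x @[y --> x^'] --> (0 : 'M[R]_(m, n)).
  apply: cvg_within_filter; rewrite -(subrr x).
  by apply: cvgB; [exact: cvg_id|exact: cvg_cst].
have near_x : \forall y \near x^', fnorm (y - x) ^+ 2 < (e / (`|C| + 1)) ^+ 2.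
  apply: (cvgr_lt _ (cvg_fnorm_sqr xx)).
  by rewrite fnorm0 expr0n/= exprn_gt0 ?divr_gt0.
near=> y.
have yx : y - x != 0 by rewrite subr_eq0; near: y; exact: nbhs_dnbhs_neq.
have d0 : 0 < fnorm (y - x) by rewrite lt0r fnorm_neq0//= fnorm_ge0.
have de : fnorm (y - x) * (`|C| + 1) < e.
  rewrite -ltr_pdivlMr// -(@ltr_pXn2r _ 2) ?nnegrE ?fnorm_ge0//; last first.
    by rewrite ltW// divr_gt0.
  by near: y.
move: (h y) fx; case: (f x) => [r| |]//; case: (f y) => [s| |]//.
  rewrite -!EFinB -EFinD -EFinM !lee_fin => hy _.
  rewrite ler_pdivlMr//.
  have := ler_norm C; have := normr_ge0 C; nra.
by move=> _ _; rewrite gt0_mulye ?leey// lte_fin invr_gt0.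
Unshelve. all: by end_near. Qed.

Lemma frechet_limiting_subdiff f x u :
  frechet_subdiff f x u -> limiting_subdiff f x u.
Proof.
move=> fxu; split; first by case: fxu.
by exists (fun=> x), (fun=> u); split => //; exact: cvg_cst.
Qed.

(* The minimizer condition is the quadratic minorant
   [f x - <G, y - x> - C |y - x|^2 <= f y]. *)
Lemma minimizer_subdiff f (q : 'M[R]_(m, n) -> R) x (G : 'M[R]_(m, n)) (C : R) :
  f x \is a fin_num ->
  (forall v, q (x + v) = q x + finner G v + C * fnorm v ^+ 2) ->
  (forall y, f x + (q x)%:E <= f y + (q y)%:E)%E ->
  limiting_subdiff f x (- G).
Proof.
move=> fx qx h; apply: frechet_limiting_subdiff.
apply: (@frechet_subdiff_minorant f x _ C) => // y.
have := qx (y - x); rewrite subrKC => qy.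
move: (h y) fx; rewrite qy finnerNl.
case: (f x) => [r| |]//; case: (f y) => [s| |]//.
2: by move=> *; rewrite leey.
by rewrite -!EFinD !lee_fin => + _; lra.
Qed.

(** By homogeneity of degree 2, the difference quotient along [v = delta_mx i j] is exactly
    [G i j + h * Q v]. Keeping [Q] abstract covers multiples of the squared norm as well as the form
    in [Z *m V^T] from the E block. *)
Lemma grad_quadratic (q Q : 'M[R]_(m, n) -> R) x (G : 'M[R]_(m, n)) :
  (forall v, q (x + v) = q x + finner G v + Q v) ->
  (forall h v, Q (h *: v) = h ^+ 2 * Q v) ->
  grad q x = G.
Proof.
move=> qx Q2; apply/matrixP => i j; rewrite mxE.
set v := delta_mx i j.
apply: cvg_lim => //=.
have lin : G i j + h * Q v @[h --> (0:R)^'] --> G i j.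
  apply: cvg_within_filter.
  have : G i j + h * Q v @[h --> (0 : R)] --> G i j + 0 * Q v; last first.
    by rewrite mul0r addr0.
  apply: cvgD; first exact: cvg_cst.
  by apply: cvgM; [exact: cvg_id|exact: cvg_cst].
apply: cvg_trans lin; apply: near_eq_cvg; near=> h => /=.
have h0 : h != 0 by near: h; exact: nbhs_dnbhs_neq.
rewrite [h *: v + x]addrC qx Q2 finnerZr finner_delta /GRing.scale/=.
by field.
Unshelve. all: by end_near. Qed.

(* Lower semicontinuity bounds [f] at the limit and the quadratics converge, so
   minimality passes to the limit. *)
Lemma minimizer_limit f (xs : nat -> 'M[R]_(m, n))
    (qs : nat -> 'M[R]_(m, n) -> R) x (q : 'M[R]_(m, n) -> R) :
  lower_semicontinuous f -> (forall y, f y != -oo%E) ->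
  xs k @[k --> \oo] --> x ->
  qs k (xs k) @[k --> \oo] --> q x ->
  (forall y, qs k y @[k --> \oo] --> q y) ->
  (forall k y, f (xs k) + (qs k (xs k))%:E <= f y + (qs k y)%:E)%E ->
  forall y, (f x + (q x)%:E <= f y + (q y)%:E)%E.
Proof.
move=> lsc fNy xsx qsx qsy h y.
case fy : (f y) => [r| |]; last 2 first.
- by rewrite addye// leey.
- by have := fNy y; rewrite fy.
rewrite leNgt; apply/negP => lt.
have {lt} : ((r + q y - q x)%:E < f x)%E.
  move: lt (fNy x); case: (f x) => [s| |]//; last by move=> *; rewrite ltry.
  by rewrite -!EFinD !lte_fin => + _; lra.
(* If minimality failed at [y], some real [a] would separate [r + q y - q x] from [f x]. Lower
   semicontinuity puts [f (xs k)] above [a] near the limit, while minimality of [xs k] puts it below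
   [a]. *)
move=> cfx; have [a ca afx] : exists2 a, r + q y - q x < a & (a%:E < f x)%E.
  move: cfx (fNy x); case: (f x) => [s| |]//; last first.
    by move=> _ _; exists (r + q y - q x + 1); rewrite ?ltry// ltrDl.
  rewrite lte_fin => cs _; exists ((r + q y - q x + s) / 2);
    rewrite ?lte_fin; lra.
have [V xV Vf] := lsc _ _ afx.
have cc : r + qs k y - qs k (xs k) @[k --> \oo] --> r + q y - q x.
  by apply: cvgB => //; apply: cvgD => //; exact: cvg_cst.
have [k [Vk]] : exists k, V (xs k) /\ r + qs k y - qs k (xs k) < a.
  apply: (@filter_ex _ \oo); apply: filterI; first exact: xsx.
  exact: (cvgr_lt _ cc).
move/Vf: Vk; move: (h k y); rewrite fy.
case: (f (xs k)) => [s| |]//.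
by rewrite -!EFinD !lee_fin !lte_fin; lra.
Qed.

End Subgradients.

(* Comparing the minimizer with its midpoint with [x0], where strong convexity
   of modulus alpha + mu - rho is felt, gains the term in max. *)
Lemma prox_descent (R : realType) m n (f : 'M[R]_(m, n) -> \bar R)
    (q : 'M[R]_(m, n) -> R) (G : 'M[R]_(m, n) -> 'M[R]_(m, n))
    (mu rho alpha : R) (x x0 : 'M[R]_(m, n)) (r r0 : R) :
  weakly_convex rho f ->
  (forall y v, q (y + v) = q y + finner (G y) v + mu / 2 * fnorm v ^+ 2) ->
  (forall y, f x + (q x + alpha / 2 * fnorm (x - x0) ^+ 2)%:E <=
             f y + (q y + alpha / 2 * fnorm (y - x0) ^+ 2)%:E)%E ->
  f x = r%:E -> f x0 = r0%:E ->
  r + q x + (alpha / 2 + Num.max (alpha + mu - rho) 0 / 4) * fnorm (x - x0) ^+ 2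
    <= r0 + q x0.
Proof.
move=> [[fNy _] _ _ _ fcvx] qE xmin fx fx0.
have descent0 : r + q x + alpha / 2 * fnorm (x - x0) ^+ 2 <= r0 + q x0.
  have := xmin x0; rewrite fx fx0 subrr fnorm0 expr0n/= mulr0 addr0.
  by rewrite -!EFinD lee_fin; lra.
have [le0|gt0] := leP (alpha + mu - rho) 0; first by rewrite mul0r addr0.
pose v := x0 - x; pose z := x + 2^-1 *: v.
have x0E : x0 = x + v by rewrite addrC subrK.
have dE : fnorm (x - x0) ^+ 2 = fnorm v ^+ 2.
  by rewrite -(opprB x0) -scaleN1r fnormZ_sqr sqrrN expr1n mul1r.
have zE : z = 2^-1 *: x0 + (1 - 2^-1) *: x.
  by rewrite /z /v scalerBr scalerBl scale1r addrCA addrA.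
have zx0 : fnorm (z - x0) ^+ 2 = fnorm v ^+ 2 / 4.
  have -> : z - x0 = - 2^-1 *: v.
    by rewrite zE /v scalerBl scale1r !scaleNr scalerBr; apply/matrixP => i j;
      rewrite !mxE; field.
  by rewrite fnormZ_sqr; field.
have qz := qE x (2^-1 *: v); have := qE x v.
rewrite -/z finnerZr fnormZ_sqr -x0E in qz * => qx0.
have zn : fnorm z ^+ 2 = fnorm x ^+ 2 + finner x v + fnorm v ^+ 2 / 4.
  by rewrite fnormD_sqr finnerZr fnormZ_sqr; field.
have x0n : fnorm x0 ^+ 2 = fnorm x ^+ 2 + 2 * finner x v + fnorm v ^+ 2.
  by rewrite {1}x0E fnormD_sqr.
have half : 0 <= (2^-1 : R) <= 1 by lra.
(* Twice the comparison with the midpoint [z] yields the coefficient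
   [3 * alpha / 4 + (mu - rho) / 4], which equals [alpha / 2 + (alpha + mu - rho) / 4]. *)
have := fcvx x0 x _ half; have := xmin z.
rewrite -zE fx fx0 zx0 dE zn x0n.
move: (fNy z); case: (f z) => [s| |]// _; rewrite -?EFinM -!EFinD ?lee_fin.
by rewrite qz qx0; nra.
Qed.

(** * Exact second-order expansions and continuity of the data term *)

Section DataFit.
Context {R : realType} {n1 n2 n3 r : nat} (delta : R) (O : tensor R n1 n2 n3).
Implicit Types (Z : tensor R n1 n2 r) (E : 'M[R]_(n3, r))
  (S : tensor R n1 n2 n3).

Lemma mode3_prodE Z E : mode3_prod Z E = Z *m E^T.
Proof.
apply/matrixP => i j; rewrite !mxE; apply: eq_bigr => k _.
by rewrite mxE.
Qed.

(** Right multiplication by [E^T] is an isometry, so the Z block has curvature exactly [delta], like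
    the S block. *)
Lemma fnorm_mul_stiefel p (V : 'M[R]_(p, r)) E :
  stiefel R n3 r E -> fnorm (V *m E^T) ^+ 2 = fnorm V ^+ 2.
Proof.
move=> EE; rewrite !fnorm_sqr finner_mulmxr trmxK -mulmxA EE mulmx1//.
Qed.

Lemma data_fitS Z E S V :
  data_fit delta O Z E (S + V) = data_fit delta O Z E S
    + finner (delta *: (Z *m E^T + S - O)) V + delta / 2 * fnorm V ^+ 2.
Proof.
rewrite /data_fit mode3_prodE.
have -> : Z *m E^T + (S + V) - O = (Z *m E^T + S - O) + V.
  by rewrite addrA [LHS]addrAC.
by rewrite [in LHS]fnormD_sqr finnerZl; field.
Qed.

Lemma data_fitZ Z E S V : stiefel R n3 r E ->
  data_fit delta O (Z + V) E S = data_fit delta O Z E S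
    + finner (delta *: ((Z *m E^T + S - O) *m E)) V + delta / 2 * fnorm V ^+ 2.
Proof.
move=> EE; rewrite /data_fit !mode3_prodE.
have -> : (Z + V) *m E^T + S - O = (Z *m E^T + S - O) + V *m E^T.
  by rewrite mulmxDl -!addrA; congr (_ + _); rewrite addrC addrA.
by rewrite [in LHS]fnormD_sqr finnerZl finner_mulmxr fnorm_mul_stiefel//; field.
Qed.

(** Valid off the Stiefel manifold too, so that it can be expanded at the base point 0. *)
Lemma data_fitE Z E S V :
  data_fit delta O Z (E + V) S = data_fit delta O Z E S
    + finner (delta *: ((Z *m E^T + S - O)^T *m Z)) V
    + delta / 2 * fnorm (Z *m V^T) ^+ 2.
Proof.
rewrite /data_fit !mode3_prodE.
have -> : Z *m (E + V)^T + S - O = (Z *m E^T + S - O) + Z *m V^T.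
  by rewrite raddfD/= mulmxDr -!addrA; congr (_ + _); rewrite addrC addrA.
rewrite [in LHS]fnormD_sqr finnerZl finner_mulmxr.
rewrite -(finner_tr (_ + _ - _)) trmx_mul trmxK (finnerC _ (V *m _)).
by rewrite finner_mulmxr trmxK finnerC; field.
Qed.

Lemma data_fit_cvg (T : Type) (F : set_system T) {FF : Filter F}
    (Zs : T -> tensor R n1 n2 r) (Es : T -> 'M[R]_(n3, r))
    (Ss : T -> tensor R n1 n2 n3) Z E S :
  Zs t @[t --> F] --> Z -> Es t @[t --> F] --> E -> Ss t @[t --> F] --> S ->
  data_fit delta O (Zs t) (Es t) (Ss t) @[t --> F] --> data_fit delta O Z E S.
Proof.
move=> hZ hE hS; apply: cvgM; first exact: cvg_cst.
apply: cvg_fnorm_sqr; apply: cvgB; last exact: cvg_cst.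
apply: cvgD => //; rewrite mode3_prodE; under eq_fun do rewrite mode3_prodE.
by apply: cvg_mulmx => //; exact: cvg_trmx.
Qed.

End DataFit.

(** * Plane rotations and linear forms on the Stiefel manifold *)

Section Stiefel.
Context {R : realType} {n r : nat}.
Implicit Types M E : 'M[R]_(n, r).

(** When [c ^+ 2 + s ^+ 2 = 1], this is [E] multiplied on the left by a Givens rotation; the row
    form lets sums be compared on the two rows [p] and [q] alone. *)
Definition givens (p q : 'I_n) (c s : R) E : 'M[R]_(n, r) :=
  \matrix_(i, j) (if i == p then c * E p j + s * E q j
                  else if i == q then c * E q j - s * E p j else E i j).

Lemma sum_two_rows (p q : 'I_n) (F1 F2 : 'I_n -> R) : p != q ->
  (forall i, i != p -> i != q -> F1 i = F2 i) ->
  \sum_i F1 i - \sum_i F2 i = F1 p + F1 q - (F2 p + F2 q).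
Proof.
move=> pq F12; have qp : q != p by rewrite eq_sym.
rewrite (bigD1 p)//= (bigD1 q)//= [\sum_i F2 i](bigD1 p)//= (bigD1 q qp)/=.
rewrite (eq_bigr F2); first by ring.
by move=> i /andP[]; exact: F12.
Qed.

Lemma givens_stiefel p q c s E : p != q -> c ^+ 2 + s ^+ 2 = 1 ->
  stiefel R n r E -> stiefel R n r (givens p q c s E).
Proof.
move=> pq cs; rewrite /stiefel/= => <-; apply/matrixP => j k; rewrite !mxE.
apply/eqP; rewrite -subr_eq0 (@sum_two_rows p q)//; last first.
  by move=> i /negbTE ip /negbTE iq; rewrite !mxE ip iq.
have qp : (q == p) = false by rewrite eq_sym; exact/negbTE.
have cs' : c ^+ 2 = 1 - s ^+ 2 by rewrite -cs addrK.
by rewrite !mxE eqxx qp eqxx; apply/eqP; ring: cs'.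
Qed.

Lemma finner_givens M E p q c s : p != q ->
  finner M (givens p q c s E) - finner M E =
    (c - 1) * ((M *m E^T) p p + (M *m E^T) q q)
    + s * ((M *m E^T) p q - (M *m E^T) q p).
Proof.
move=> pq; rewrite (@sum_two_rows p q)//; last first.
  move=> i /negbTE ip /negbTE iq; apply: eq_bigr => k _.
  by rewrite mxE ip iq.
have qp : (q == p) = false by rewrite eq_sym; exact/negbTE.
have -> : \sum_j M p j * givens p q c s E p j =
    c * (M *m E^T) p p + s * (M *m E^T) p q.
  rewrite !mxE !mulr_sumr -big_split; apply: eq_bigr => k _ /=.
  by rewrite !mxE eqxx; ring.
have -> : \sum_j M q j * givens p q c s E q j =
    c * (M *m E^T) q q - s * (M *m E^T) q p.
  rewrite !mxE !mulr_sumr -sumrB; apply: eq_bigr => k _ /=.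
  by rewrite !mxE qp eqxx; ring.
have EE i : \sum_j M i j * E i j = (M *m E^T) i i.
  by rewrite mxE; apply: eq_bigr => k _; rewrite mxE.
by rewrite !EE; ring.
Qed.

(* Rotate E in the (p, q)-plane by c = (1 - t^2) / (1 + t^2),
   s = 2 t / (1 + t^2): maximality leaves t D <= t^2 A for every t. *)
Lemma stiefel_linear_max_sym M E : stiefel R n r E ->
  (forall E', stiefel R n r E' -> finner M E' <= finner M E) ->
  M *m E^T = E *m M^T.
Proof.
move=> EE Mmax.
suff sym p q : p != q -> (M *m E^T) p q = (M *m E^T) q p.
  rewrite -[E in RHS]trmxK -trmx_mul; apply/matrixP => p q; rewrite [RHS]mxE.
  by have [->//|] := eqVneq p q; exact: sym.
move=> pq; apply/eqP; rewrite -subr_eq0.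
set D := _ - _; set A := (M *m E^T) p p + (M *m E^T) q q.
have tDA t : t * D <= t ^+ 2 * A.
  have t1 : 0 < 1 + t ^+ 2 by rewrite ltr_pwDl// sqr_ge0.
  have cs : ((1 - t ^+ 2) / (1 + t ^+ 2)) ^+ 2 + (2 * t / (1 + t ^+ 2)) ^+ 2 = 1.
    by field; rewrite gt_eqF.
  have := Mmax _ (givens_stiefel pq cs EE).
  rewrite -subr_le0 finner_givens// -/D -/A.
  have -> : ((1 - t ^+ 2) / (1 + t ^+ 2) - 1) * A + 2 * t / (1 + t ^+ 2) * D =
            2 / (1 + t ^+ 2) * (t * D - t ^+ 2 * A).
    by field; rewrite gt_eqF.
  by rewrite pmulr_rle0 ?divr_gt0// subr_le0.
have a0 : 0 < `|A| + 1 by rewrite ltr_wpDl.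
(* With this [t] the inequality [t * D <= t ^+ 2 * A] reads [t ^+ 2 * (|A| + 1) <= t ^+ 2 * A],
   which forces [t = 0] and hence [D = 0]. *)
pose t := D / (`|A| + 1).
have Dt : D = t * (`|A| + 1) by rewrite divfK// gt_eqF.
have t2 : t ^+ 2 <= 0.
  by have := tDA t; rewrite Dt; have := ler_norm A; have := sqr_ge0 t; nra.
have : t == 0 by rewrite -sqrf_eq0 eq_le t2 sqr_ge0.
by move=> /eqP t0; rewrite Dt t0 mul0r.
Qed.

Lemma proj_tangentD E X Y :
  proj_tangent E (X + Y) = proj_tangent E X + proj_tangent E Y.
Proof.
rewrite /proj_tangent [(X + Y)^T]linearD/= mulmxDl !mulmxDr.
by apply/matrixP => i j; rewrite !mxE; ring.
Qed.

Lemma proj_tangentZ E a X : proj_tangent E (a *: X) = a *: proj_tangent E X.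
Proof.
rewrite /proj_tangent.
have -> : E^T *m (a *: X) + (a *: X)^T *m E = a *: (E^T *m X + X^T *m E).
  by rewrite [(a *: X)^T]linearZ/= -scalemxAl -scalemxAr scalerDr.
by rewrite -scalemxAr scalerBr !scalerA mulrC.
Qed.

(** These products are the normal vectors at [E]: the bracket in the projection becomes [2 *: A],
    and its half cancels [E *m A]. *)
Lemma proj_tangent_mul_sym E (A : 'M[R]_r) : stiefel R n r E ->
  A^T = A -> proj_tangent E (E *m A) = 0.
Proof.
move=> EE AA; rewrite /proj_tangent trmx_mul AA -!mulmxA.
have EE' : E^T *m E = 1%:M := EE.
rewrite EE' mulmx1 [E^T *m _]mulmxA EE' mul1mx.
by rewrite -mulr2n -[A *+ 2]scaler_nat -scalemxAr scalerA mulVf// scale1r subrr.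
Qed.

(** Symmetry of [M *m E^T] gives [M = E *m (M^T *m E)] with [M^T *m E] symmetric, so [M] is normal
    at [E]. *)
Lemma proj_tangent_linear_max M E : stiefel R n r E ->
  (forall E', stiefel R n r E' -> finner M E' <= finner M E) ->
  proj_tangent E M = 0.
Proof.
move=> EE Mmax; have sym := stiefel_linear_max_sym EE Mmax.
have EE' : E^T *m E = 1%:M := EE.
have -> : M = E *m (M^T *m E) by rewrite mulmxA -sym -mulmxA EE' mulmx1.
apply: proj_tangent_mul_sym => //.
rewrite trmx_mul trmxK -[LHS]mulmx1 -EE' mulmxA -(mulmxA E^T) sym.
by rewrite mulmxA EE' mul1mx.
Qed.

End Stiefel.

(** * Passing to the limit in proximal subproblems *)

Section ProximalLimits.
Context {R : realType} {m n : nat}.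
Implicit Types (f : 'M[R]_(m, n) -> \bar R) (q : 'M[R]_(m, n) -> R).

(** Iterates [xs] and centers [cs] share the limit [x], so the proximal term dies on the left and is
    centered at [x] on the right. *)
Lemma prox_limit f (xs cs : nat -> 'M[R]_(m, n))
    (qs : nat -> 'M[R]_(m, n) -> R) (x : 'M[R]_(m, n)) q (alpha : R) :
  lower_semicontinuous f -> (forall y, f y != -oo%E) ->
  xs k @[k --> \oo] --> x -> cs k @[k --> \oo] --> x ->
  qs k (xs k) @[k --> \oo] --> q x ->
  (forall y, qs k y @[k --> \oo] --> q y) ->
  (forall k y, f (xs k) + (qs k (xs k) + alpha / 2 * fnorm (xs k - cs k) ^+ 2)%:E
    <= f y + (qs k y + alpha / 2 * fnorm (y - cs k) ^+ 2)%:E)%E ->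
  forall y, (f x + (q x)%:E <= f y + (q y + alpha / 2 * fnorm (y - x) ^+ 2)%:E)%E.
Proof.
move=> lsc fNy xsx csx qsx qsy h y.
pose p (c z : 'M[R]_(m, n)) := alpha / 2 * fnorm (z - c) ^+ 2.
have p_cvg (zs : nat -> 'M[R]_(m, n)) (z : 'M[R]_(m, n)) :
    zs k @[k --> \oo] --> z -> p (cs k) (zs k) @[k --> \oo] --> p x z.
  move=> zsz; apply: cvgM; first exact: cvg_cst.
  by apply: cvg_fnorm_sqr; exact: cvgB.
have -> : q x = q x + p x x by rewrite /p subrr fnorm0 expr0n/= mulr0 addr0.
apply: (@minimizer_limit _ _ _ f xs (fun k z => qs k z + p (cs k) z) x
  (fun z => q z + p x z) lsc fNy xsx) => //.
- by apply: cvgD => //; exact: p_cvg.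
- by move=> z; apply: cvgD => //; apply: p_cvg; exact: cvg_cst.
Qed.

(** A proximal term centered at [x] has zero gradient there: it raises the curvature to [mu + alpha]
    and leaves [G] unchanged. *)
Lemma prox_fixpoint_subdiff f q x (G : 'M[R]_(m, n)) (mu alpha : R) :
  f x \is a fin_num ->
  (forall v, q (x + v) = q x + finner G v + mu / 2 * fnorm v ^+ 2) ->
  (forall y, f x + (q x)%:E <= f y + (q y + alpha / 2 * fnorm (y - x) ^+ 2)%:E)%E ->
  limiting_subdiff f x (- G).
Proof.
move=> fx qx h.
apply: (@minimizer_subdiff _ _ _ f (fun y => q y + alpha / 2 * fnorm (y - x) ^+ 2)
  x G ((mu + alpha) / 2)) => //.
  by move=> v; rewrite qx [x + v]addrC addrK subrr fnorm0; field.
by move=> y; rewrite subrr fnorm0 expr0n/= mulr0 addr0.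
Qed.

End ProximalLimits.

(** * Sufficient decrease, vanishing steps and subsequences *)

Section RealSequences.
Context {R : realType}.
Implicit Types a d : nat -> R.

(** The sequence [a] decreases and is bounded below, hence converges, and [d k] is squeezed between
    0 and [a k - a k.+1]. *)
Lemma descent_cvg0 a d (lb : R) :
  (forall k, 0 <= d k) -> (forall k, lb <= a k) ->
  (forall k, a k.+1 + d k <= a k) -> d k @[k --> \oo] --> 0.
Proof.
move=> d0 alb ad.
have ani : nonincreasing_seq a.
  by apply/nonincreasing_seqP => k; apply: le_trans (ad k); rewrite lerDl.
have acvg : cvgn a.
  by apply: nonincreasing_is_cvgn => //; exists lb => _ [k _ <-].
have aS : a k.+1 @[k --> \oo] --> limn a by rewrite (cvg_shiftS a).
have diff0 : a k - a k.+1 @[k --> \oo] --> 0.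
  by rewrite -(subrr (limn a)); exact: cvgB.
apply: (squeeze_cvgr _ _ diff0); last exact: cvg_cst.
by near=> k; rewrite d0/= lerBrDl.
Unshelve. all: by end_near. Qed.

Lemma fnorm_sqr_le_cvg0 m n (A : nat -> 'M[R]_(m, n)) d (c : R) :
  0 < c -> (forall k, c * fnorm (A k) ^+ 2 <= d k) ->
  d k @[k --> \oo] --> 0 -> A k @[k --> \oo] --> (0 : 'M[R]_(m, n)).
Proof.
move=> c0 Ad d0; apply: fnorm_sqr_cvg0.
have cd0 : c^-1 * d k @[k --> \oo] --> 0.
  by rewrite -(mulr0 c^-1); apply: cvgM => //; exact: cvg_cst.
apply: (squeeze_cvgr _ _ cd0); last exact: cvg_cst.
by near=> k; rewrite sqr_ge0/= ler_pdivlMl.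
Unshelve. all: by end_near. Qed.

(** For each [j], pick an index at least [j] whose term lies within [1 / (j + 1)] of [p]. The map
    [s] tends to infinity but may fail to be increasing, which suffices for composing limits. *)
Lemma cluster_subseq (V : pseudoMetricType R) (u : nat -> V) (p : V) :
  cluster (u k @[k --> \oo]) p ->
  exists2 s : nat -> nat, s j @[j --> \oo] --> \oo & u (s j) @[j --> \oo] --> p.
Proof.
move=> clp.
have near_p (j : nat) : exists k : nat, (j <= k)%N /\ ball p j.+1%:R^-1 (u k).
  have [] := clp (u @` [set k | (j <= k)%N]) (ball p j.+1%:R^-1).
  - by exists j => // k /= jk; exists k.
  - by apply: nbhsx_ballx; rewrite invr_gt0.
  by move=> _ [[k jk <-] pk]; exists k.
have [s sP] := choice near_p; exists s.
  apply/cvgnyPge => N; near=> j.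
  by apply: leq_trans (sP j).1; near: j; exact: nbhs_infty_ge.
apply/cvg_ballP => e e0; near=> j.
apply: le_ball (sP j).2; apply: ltW.
by near: j; exact: near_infty_natSinv_lt (PosNum e0).
Unshelve. all: by end_near. Qed.

End RealSequences.

Lemma stiefel_closed (R : realType) n r (Es : nat -> 'M[R]_(n, r)) E :
  (forall k, stiefel R n r (Es k)) -> Es k @[k --> \oo] --> E ->
  stiefel R n r E.
Proof.
move=> EsP EsE; apply/matrixP => i j.
have EE : (Es k)^T *m Es k @[k --> \oo] --> E^T *m E.
  by apply: cvg_mulmx => //; exact: cvg_trmx.
have cij := cvg_mx_entry (i := i) (j := j) EE.
apply: (cvg_unique (@norm_hausdorff _ R) cij).
have EsP' k : (Es k)^T *m Es k = 1%:M := EsP k.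
rewrite (_ : (fun k => _) = fun=> (1%:M : 'M[R]_r) i j); first exact: cvg_cst.
by apply/funext => k /=; rewrite EsP'.
Qed.

(** * Descent of the algorithm and stationarity of accumulation points *)

Section Stationarity.
Context {R : realType} {n1 n2 n3 r : nat} (O : tensor R n1 n2 n3).
Context (delta tau : R) (psi : R -> R) (Reg : tensor R n1 n2 r -> \bar R).
Hypotheses (delta0 : 0 < delta) (tau0 : 0 < tau).
Hypothesis psi0 : forall t, 0 <= psi t.

(* On the Stiefel manifold both quadratics in E' are constant up to a linear
   term, so E maximizes a linear form. *)
Lemma stiefel_prox_stationary (Z : tensor R n1 n2 r) (E : 'M[R]_(n3, r))
    (S : tensor R n1 n2 n3) (alpha : R) :
  stiefel R n3 r E ->
  (forall E', stiefel R n3 r E' -> data_fit delta O Z E S <=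
     data_fit delta O Z E' S + alpha / 2 * fnorm (E' - E) ^+ 2) ->
  rgrad (fun E' => data_fit delta O Z E' S) E = 0.
Proof.
move=> EE Emin.
(* The linear coefficient of the data term expanded at [E = 0]. *)
pose G' : 'M[R]_(n3, r) := delta *: ((S - O)^T *m Z).
have fitE' E' : stiefel R n3 r E' -> data_fit delta O Z E' S =
    data_fit delta O Z 0 S + finner G' E' + delta / 2 * fnorm Z ^+ 2.
  move=> EE'; rewrite -{1}[E']add0r data_fitE fnorm_mul_stiefel//.
  by rewrite trmx0 mulmx0 add0r.
have normE' E' : stiefel R n3 r E' -> fnorm E' ^+ 2 = fnorm (1%:M : 'M[R]_r) ^+ 2.
  move=> EE'; rewrite -(fnorm_mul_stiefel (1%:M : 'M[R]_r) EE') mul1mx !fnorm_sqr.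
  by rewrite finner_tr.
(* On the manifold all norms agree, so the proximal term contributes only [- alpha * finner E' E]
   and a constant; minimality becomes maximality of the form [alpha *: E - G']. *)
have projM : proj_tangent E (alpha *: E - G') = 0.
  apply: proj_tangent_linear_max => // E' EE'.
  have := Emin E' EE'; rewrite (fitE' E EE) (fitE' E' EE').
  rewrite fnormD_sqr (normE' E' EE').
  rewrite -[- E]scaleN1r fnormZ_sqr sqrrN expr1n mul1r scaleN1r finnerNr.
  rewrite /G' !finnerDl !finnerNl !finnerZl (finnerC E' E).
  rewrite -(normE' E EE) (fnorm_sqr E).
  by lra.
rewrite /rgrad (@grad_quadratic _ _ _ _
  (fun V : 'M[R]_(n3, r) => delta / 2 * fnorm (Z *m V^T) ^+ 2) _ _
  (data_fitE _ _ _ _ _)).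
  (* The gradient is [E] times a symmetric matrix minus the maximized form, and the projection kills
     both. *)
  have -> : delta *: ((Z *m E^T + S - O)^T *m Z) =
      E *m (alpha%:M + delta *: (Z^T *m Z)) + -1 *: (alpha *: E - G').
    rewrite /G' -addrA; set W := S - O.
    rewrite [(_ + W)^T]linearD/= mulmxDl trmx_mul trmxK scalerDr.
    rewrite mulmxDr mul_mx_scalar -scalemxAr mulmxA scaleN1r opprB.
    by rewrite addrC [RHS]addrC addrA subrK.
  rewrite proj_tangentD proj_tangentZ projM scaler0 addr0.
  apply: proj_tangent_mul_sym => //.
  by rewrite linearD/= tr_scalar_mx linearZ/= trmx_mul trmxK.
by move=> h V; rewrite linearZ/= -scalemxAr fnormZ_sqr; ring.
Qed.

Lemma group_sparsity_ge0 (S : tensor R n1 n2 n3) : 0 <= group_sparsity psi S.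
Proof. by do 2! apply: sumr_ge0 => ? _. Qed.

Lemma data_fit_ge0 (Z : tensor R n1 n2 r) E (S : tensor R n1 n2 n3) :
  0 <= data_fit delta O Z E S.
Proof. by rewrite mulr_ge0 ?sqr_ge0// divr_ge0// ltW. Qed.

Context (rho1 rho2 alphaS alphaE alphaZ : R).
Hypothesis sparsity_wcvx : weakly_convex rho1
  (fun S : tensor R n1 n2 n3 => (tau * group_sparsity psi S)%:E).
Hypothesis Reg_wcvx : weakly_convex rho2 Reg.
Hypotheses (alphaS0 : 0 <= alphaS) (alphaZ0 : 0 <= alphaZ).
Hypothesis alphaE0 : 0 < alphaE.
Hypothesis alpha_rho1 : 0 < alphaS + Num.max (alphaS + delta - rho1) 0.
Hypothesis alpha_rho2 : 0 < alphaZ + Num.max (alphaZ + delta - rho2) 0.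
Context (Z : nat -> tensor R n1 n2 r) (E : nat -> 'M[R]_(n3, r))
  (S : nat -> tensor R n1 n2 n3).
Hypothesis ZES : pnp_pbcd O delta tau psi Reg alphaS alphaE alphaZ Z E S.

Lemma pbcd_stiefel k : stiefel R n3 r (E k).
Proof. by case: ZES => E0 step; case: k => // k; case: (step k) => _ []. Qed.

(** Comparison with a point of the domain of [Reg] bounds the minimum. The index starts at 1 because
    the initial [Z 0] may lie outside that domain. *)
Lemma pbcd_Reg_fin k : Reg (Z k.+1) \is a fin_num.
Proof.
case: ZES => _ /(_ k)[_ _ [_ Zmin]].
case: Reg_wcvx => -[RegNy [Z0 RegZ0]] _ _ _ _.
rewrite fin_real// ltNye RegNy/=.
move: (Zmin Z0 I) (RegNy Z0) RegZ0 (RegNy (Z k.+1)).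
case: (Reg Z0) => [s| |]//; case: (Reg (Z k.+1)) => [s'| |]// _ _ _ _.
by rewrite ltry.
Qed.

Lemma pbcd_minS k S' :
  ((tau * group_sparsity psi (S k.+1))%:E +
    (data_fit delta O (Z k) (E k) (S k.+1) + alphaS / 2 * fnorm (S k.+1 - S k) ^+ 2)%:E
   <= (tau * group_sparsity psi S')%:E +
    (data_fit delta O (Z k) (E k) S' + alphaS / 2 * fnorm (S' - S k) ^+ 2)%:E)%E.
Proof.
case: ZES => _ /(_ k)[[_ Smin] _ _]; have := Smin S' I.
by rewrite -!EFinD !lee_fin; lra.
Qed.

Lemma pbcd_minZ k Z' :
  (Reg (Z k.+1) + (data_fit delta O (Z k.+1) (E k.+1) (S k.+1)
                   + alphaZ / 2 * fnorm (Z k.+1 - Z k) ^+ 2)%:E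
   <= Reg Z' + (data_fit delta O Z' (E k.+1) (S k.+1)
                + alphaZ / 2 * fnorm (Z' - Z k) ^+ 2)%:E)%E.
Proof.
case: ZES => _ /(_ k)[_ _ [_ Zmin]]; have := Zmin Z' I.
by rewrite !EFinD ![(_%:E + Reg _)%E]addeC -!addeA.
Qed.

(** The coefficient given by [prox_descent] with [mu = delta]. *)
Let gain (alpha rho : R) := alpha / 2 + Num.max (alpha + delta - rho) 0 / 4.

Let gain_gt0 alpha rho :
  0 <= alpha -> 0 < alpha + Num.max (alpha + delta - rho) 0 -> 0 < gain alpha rho.
Proof.
move=> a0; have : 0 <= Num.max (alpha + delta - rho) 0 by rewrite le_max lexx orbT.
by rewrite /gain; lra.
Qed.

Let gap k := gain alphaS rho1 * fnorm (S k.+1 - S k) ^+ 2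
  + alphaE / 2 * fnorm (E k.+1 - E k) ^+ 2
  + gain alphaZ rho2 * fnorm (Z k.+1 - Z k) ^+ 2.

(** The objective as a real number; [fine] is faithful from index 1 on. *)
Let value k := data_fit delta O (Z k) (E k) (S k)
  + tau * group_sparsity psi (S k) + fine (Reg (Z k)).

(** The three block decreases telescope, since each block starts from the values left by the
    previous one. The E block lacks convexity and gains only its proximal term. *)
Lemma pbcd_descent k : value k.+2 + gap k.+1 <= value k.+1.
Proof.
have dS := prox_descent sparsity_wcvx (data_fitS delta O (Z k.+1) (E k.+1))
  (pbcd_minS k.+1) erefl erefl.
have dZ := prox_descent Reg_wcvx
  (fun Z' V => data_fitZ delta O Z' (S k.+2) V (pbcd_stiefel k.+2))
  (pbcd_minZ k.+1) (esym (fineK (pbcd_Reg_fin k.+1)))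
  (esym (fineK (pbcd_Reg_fin k))).
have dE : data_fit delta O (Z k.+1) (E k.+2) (S k.+2)
    + alphaE / 2 * fnorm (E k.+2 - E k.+1) ^+ 2
    <= data_fit delta O (Z k.+1) (E k.+1) (S k.+2).
  case: ZES => _ /(_ k.+1)[_ [_ Emin] _].
  have := Emin (E k.+1) (pbcd_stiefel k.+1).
  by rewrite lee_fin subrr fnorm0 expr0n/= mulr0 addr0.
by move: dS dZ dE; rewrite /value /gap /gain; lra.
Qed.

Let gap_terms_ge0 k :
  [/\ 0 <= gain alphaS rho1 * fnorm (S k.+1 - S k) ^+ 2,
      0 <= alphaE / 2 * fnorm (E k.+1 - E k) ^+ 2
    & 0 <= gain alphaZ rho2 * fnorm (Z k.+1 - Z k) ^+ 2].
Proof.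
have gS := gain_gt0 alphaS0 alpha_rho1; have gZ := gain_gt0 alphaZ0 alpha_rho2.
have gE : 0 < alphaE / 2 by rewrite divr_gt0.
by split; rewrite mulr_ge0 ?sqr_ge0// ltW.
Qed.

Lemma pbcd_gap_cvg0 : gap k @[k --> \oo] --> 0.
Proof.
(* Descent is known only from index 1, so the first gap is dropped. *)
rewrite -(cvg_shiftS gap).
case: Reg_wcvx => _ _ [lb Reglb] _ _.
apply: (@descent_cvg0 _ (fun k => value k.+1) _ lb) => [k|k|k].
- by have [] := gap_terms_ge0 k.+1; rewrite /gap; lra.
- have := Reglb (Z k.+1); rewrite -(fineK (pbcd_Reg_fin k)) lee_fin => lbk.
  rewrite /value -[leLHS]add0r lerD//.
  by rewrite addr_ge0 ?data_fit_ge0// mulr_ge0 ?group_sparsity_ge0// ltW.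
- exact: pbcd_descent.
Qed.

Lemma pbcd_diff_cvg0 :
  [/\ Z k.+1 - Z k @[k --> \oo] --> (0 : tensor R n1 n2 r),
      E k.+1 - E k @[k --> \oo] --> (0 : 'M[R]_(n3, r))
    & S k.+1 - S k @[k --> \oo] --> (0 : tensor R n1 n2 n3)].
Proof.
have gS := gain_gt0 alphaS0 alpha_rho1; have gZ := gain_gt0 alphaZ0 alpha_rho2.
have gE : 0 < alphaE / 2 by rewrite divr_gt0.
split; [apply: (fnorm_sqr_le_cvg0 gZ _ pbcd_gap_cvg0)
       |apply: (fnorm_sqr_le_cvg0 gE _ pbcd_gap_cvg0)
       |apply: (fnorm_sqr_le_cvg0 gS _ pbcd_gap_cvg0)] => k;
  by have [] := gap_terms_ge0 k; rewrite /gap; lra.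
Qed.

Lemma pbcd_cluster_stationary Zbar Ebar Sbar :
  cluster ((Z k, E k, S k) @[k --> \oo]) (Zbar, Ebar, Sbar) ->
  first_order_stationary O delta tau psi Reg Zbar Ebar Sbar.
Proof.
move=> /cluster_subseq[s s_oo ZESs].
have ZEs : (Z (s j), E (s j)) @[j --> \oo] --> (Zbar, Ebar).
  exact: (cvg_comp _ _ ZESs cvg_fst).
have Ss : S (s j) @[j --> \oo] --> Sbar by exact: (cvg_comp _ _ ZESs cvg_snd).
have Zs : Z (s j) @[j --> \oo] --> Zbar by exact: (cvg_comp _ _ ZEs cvg_fst).
have Es : E (s j) @[j --> \oo] --> Ebar by exact: (cvg_comp _ _ ZEs cvg_snd).
have [dZ dE dS] := pbcd_diff_cvg0.
(* Since steps vanish, successors along the subsequence have the same limit; the mixed old and new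
   indices in each subproblem then merge. *)
have next m n (A : nat -> 'M[R]_(m, n)) (B : 'M[R]_(m, n)) :
    A k.+1 - A k @[k --> \oo] --> (0 : 'M[R]_(m, n)) ->
    A (s j) @[j --> \oo] --> B -> A (s j).+1 @[j --> \oo] --> B.
  move=> dA As; rewrite -(addr0 B).
  rewrite (_ : (fun j => A (s j).+1) = fun j => A (s j) + (A (s j).+1 - A (s j))).
    by apply: cvgD => //; exact: (cvg_comp _ _ s_oo dA).
  by apply/funext => j; rewrite subrKC.
have Zs1 := next _ _ _ _ dZ Zs; have Es1 := next _ _ _ _ dE Es.
have Ss1 := next _ _ _ _ dS Ss.
have EE : stiefel R n3 r Ebar.
  by apply: (@stiefel_closed _ _ _ (fun j => E (s j))) => // j; exact: pbcd_stiefel.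
have cstc (V : topologicalType) (v : V) : (fun=> v) j @[j --> \oo] --> v.
  exact: cvg_cst.
split=> //.
- have fitS := data_fitS delta O Zbar Ebar Sbar.
  pose T := Zbar *m Ebar^T + Sbar - O.
  exists (- (tau^-1 *: (delta *: T))); last first.
    rewrite (grad_quadratic fitS).
      by rewrite scalerN (scalerA tau) divff ?gt_eqF// scale1r subrr.
    by move=> h v; rewrite fnormZ_sqr; ring.
  case: sparsity_wcvx => -[SNy _] Slsc _ _ _.
  (* The S update uses the old [Z] and [E], hence [Zs] and [Es] next to the shifted [Ss1]. *)
  have Smin S' : ((tau * group_sparsity psi Sbar)%:E
        + (data_fit delta O Zbar Ebar Sbar)%:E
      <= (tau * group_sparsity psi S')%:E
        + (data_fit delta O Zbar Ebar S'
           + alphaS / 2 * fnorm (S' - Sbar) ^+ 2)%:E)%E.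
    exact: (prox_limit Slsc SNy Ss1 Ss (data_fit_cvg Zs Es Ss1)
      (fun y => data_fit_cvg Zs Es (cstc _ y)) (fun j => pbcd_minS (s j))).
  (* Weak convexity concerns [tau * group_sparsity], stationarity the subdifferential of
     [group_sparsity]; everything is divided by [tau > 0]. *)
  apply: (@prox_fixpoint_subdiff _ _ _ _
    (fun S' => tau^-1 * data_fit delta O Zbar Ebar S') _ _
    (tau^-1 * delta) (tau^-1 * alphaS)) => //.
    by move=> v; rewrite fitS !finnerZl; ring.
  move=> S'; have := Smin S'; rewrite /= -!EFinD !lee_fin => minS.
  have scale x y : x + tau^-1 * y = tau^-1 * (tau * x + y).
    by field; rewrite gt_eqF.
  rewrite -(mulrA tau^-1) -(mulrA tau^-1) -mulrDr !scale.
  by rewrite ler_pM2l ?invr_gt0.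
- apply: (@stiefel_prox_stationary Zbar Ebar Sbar alphaE EE) => E' EE'.
  have lhs : data_fit delta O (Z (s j)) (E (s j).+1) (S (s j).+1)
     + alphaE / 2 * fnorm (E (s j).+1 - E (s j)) ^+ 2 @[j --> \oo] -->
     data_fit delta O Zbar Ebar Sbar + alphaE / 2 * fnorm (Ebar - Ebar) ^+ 2.
    apply: cvgD; first exact: data_fit_cvg.
    by apply: cvgM; [exact: cvg_cst|apply: cvg_fnorm_sqr; exact: cvgB].
  have rhs : data_fit delta O (Z (s j)) E' (S (s j).+1)
     + alphaE / 2 * fnorm (E' - E (s j)) ^+ 2 @[j --> \oo] -->
     data_fit delta O Zbar E' Sbar + alphaE / 2 * fnorm (E' - Ebar) ^+ 2.
    apply: cvgD; first by apply: data_fit_cvg => //; exact: cvg_cst.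
    by apply: cvgM; [exact: cvg_cst|apply: cvg_fnorm_sqr; exact: cvgB].
  have -> : data_fit delta O Zbar Ebar Sbar =
      data_fit delta O Zbar Ebar Sbar + alphaE / 2 * fnorm (Ebar - Ebar) ^+ 2.
    by rewrite subrr fnorm0 expr0n/= mulr0 addr0.
  apply: (ler_cvg_to lhs rhs).
  near=> j; case: ZES => _ /(_ (s j))[_ [_ Emin] _].
  by have := Emin E' EE'; rewrite lee_fin.
- have fitZ V := data_fitZ delta O Zbar Sbar V EE.
  exists (- (delta *: ((Zbar *m Ebar^T + Sbar - O) *m Ebar))); last first.
    rewrite (grad_quadratic fitZ) ?subrr//.
    by move=> h v; rewrite fnormZ_sqr; ring.
  case: Reg_wcvx => -[RegNy [Z0 RegZ0]] Reglsc _ _ _.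
  have Zmin Z' : (Reg Zbar + (data_fit delta O Zbar Ebar Sbar)%:E
      <= Reg Z' + (data_fit delta O Z' Ebar Sbar
                   + alphaZ / 2 * fnorm (Z' - Zbar) ^+ 2)%:E)%E.
    exact: (prox_limit Reglsc RegNy Zs1 Zs (data_fit_cvg Zs1 Es1 Ss1)
      (fun y => data_fit_cvg (cstc _ y) Es1 Ss1) (fun j => pbcd_minZ (s j))).
  apply: (prox_fixpoint_subdiff _ fitZ Zmin).
  (* An infinite [Reg Zbar] would contradict minimality against [Z0], where [Reg] is finite. *)
  rewrite fin_numE RegNy/=; apply/eqP => Regoo.
  move: RegZ0 (RegNy Z0) (Zmin Z0); rewrite Regoo.
  by case: (Reg Z0) => [z0| |].
Unshelve. all: by end_near. Qed.

End Stationarity.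

Theorem theorem4p5 (R : realType) (n1 n2 n3 r : nat)
    (hn1 : (0 < n1)%N) (hn2 : (0 < n2)%N) (hn3 : (0 < n3)%N) (hr : (0 < r)%N)
    (hrn3 : (r <= n3)%N)
    (O : tensor R n1 n2 n3) (delta tau : R) (hdelta : 0 < delta)
    (htau : 0 < tau)
    (psi : R -> R) (hpsi : forall t, 0 <= psi t)
    (sigma : 'I_r -> R) (N : R -> 'M[R]_(n1, n2) -> 'M[R]_(n1, n2))
    (L : R -> R) (gamma a b lambda : R)
    (hN : forall k : 'I_r, class_C 2 (N (sigma k)))
    (hg : forall k : 'I_r, class_C 2 (g_denoise (N (sigma k))))
    (hL : forall k : 'I_r,
      lipschitz_grad (L (sigma k)) (g_denoise (N (sigma k))))
    (hgamma : 0 <= gamma <= 1)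
    (hgammaL : forall k : 'I_r, gamma * L (sigma k) < 1)
    (ha : 0 < a) (hlambda : 0 < lambda)
    (rho1 rho2 : R) (hrho1 : 0 <= rho1) (hrho2 : 0 <= rho2)
    (A1 : weakly_convex rho1
      (fun S : tensor R n1 n2 n3 => (tau * group_sparsity psi S)%:E))
    (A2 : coercive (Phi lambda gamma a b N sigma) /\
          weakly_convex rho2 (Phi lambda gamma a b N sigma))
    (alphaS alphaE alphaZ : R)
    (halphaS : 0 <= alphaS) (halphaZ : 0 <= alphaZ) (halphaE : 0 < alphaE)
    (hS : 0 < alphaS + Num.max (alphaS + delta - rho1) 0)
    (hZ : 0 < alphaZ + Num.max (alphaZ + delta - rho2) 0)
    (Z : nat -> tensor R n1 n2 r) (E : nat -> 'M[R]_(n3, r))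
    (S : nat -> tensor R n1 n2 n3)
    (hseq : pnp_pbcd O delta tau psi (Phi lambda gamma a b N sigma)
              alphaS alphaE alphaZ Z E S) :
  forall (Zbar : tensor R n1 n2 r) (Ebar : 'M[R]_(n3, r))
         (Sbar : tensor R n1 n2 n3),
    cluster ((Z k, E k, S k) @[k --> \oo]) (Zbar, Ebar, Sbar) ->
    first_order_stationary O delta tau psi (Phi lambda gamma a b N sigma)
      Zbar Ebar Sbar.
Proof.
move=> Zbar Ebar Sbar; case: A2 => _ Phi_wcvx.
exact: (pbcd_cluster_stationary hdelta htau hpsi A1 Phi_wcvx
  halphaS halphaZ halphaE hS hZ hseq).
Qed.
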